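(* For $i\in\{2,3\}$ and integers $b_j>0$, there is a unique way to write a positive integer in the form $$[[[({b_m}\oplus_i^{\leftarrow}q_{a_m})\oplus_{i-1}\cdots]\oplus_{i-1}({b_3}\oplus_i^{\leftarrow}q_{a_3})]\oplus_{i-1}({b_2}\oplus_i^{\leftarrow}q_{a_2})]\oplus_{i-1}({b_1}\oplus_i^{\leftarrow}q_{a_1}),$$ where each $q_{a_k}$ is a $\oplus_{i-1}$-prime and $q_{a_k}$ does not divide $$[({b_m}\oplus_i^{\leftarrow}q_{a_m})\oplus_{i-1}\cdots]\oplus_{i-1}({b_{k+1}}\oplus_i^{\leftarrow}q_{a_{k+1}})$$ for all $k$.
   Context: Operations on positive integers: $a\oplus_1 b=a\cdot b$ (usual multiplication); $a\oplus_2 b=b^a$ (exponentiation); $b\oplus_2^{\leftarrow}q=q^{b}$; and $b\oplus_3^{\leftarrow}q=q\oplus_2(\cdots\oplus_2(q\oplus_2(q\oplus_2 q)))$ with $b$ occurrences of $q$, that is, $b\oplus_3^{\leftarrow}q=q^{\,q^{\,b-1}}$. A $\oplus_1$-prime is a usual prime number. A $\oplus_2$-prime (also called an exponential prime) is a positive integer $q$ that cannot be written as $u^v$ for positive integers $u,v$ with $u>1$ and $v>1$. The $a_k$ are only subscripts labelling the primes that occur. *)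

(* Defs.v *)
From mathcomp Require Import all_boot.

Set Implicit Arguments.
Unset Strict Implicit.
Unset Printing Implicit Defensive.

(* Only levels 1 and 2 are meaningful; the exponent of level 2 is on the left. *)
Definition oplus (j a b : nat) : nat :=
  match j with
  | 1 => a * b
  | 2 => b ^ a
  | _ => 0
  end.

(* q (+)_(i-1) (... (+)_(i-1) (q (+)_(i-1) q)) with b occurrences of q; the
   value 1 at b = 0 is junk. *)
Definition oplus_left (i b q : nat) : nat := iterop b (oplus i.-1) q 1.

Lemma oplus_left2E b q : oplus_left 2 b q = q ^ b.
Proof. by []. Qed.

Lemma oplus_left3E b q : 0 < b -> oplus_left 3 b q = q ^ (q ^ b.-1).
Proof.
case: b => // b _; elim: b => [|b IHb]; first by rewrite expn0 expn1.
have -> : oplus_left 3 b.+2 q = oplus_left 3 b.+1 q ^ q by [].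
by rewrite IHb -expnM -expnSr.
Qed.

(* 1 is an exponential prime. *)
Definition exp_prime (q : nat) : Prop :=
  0 < q /\ ~ (exists u v : nat, [/\ 1 < u, 1 < v & q = u ^ v]).

Definition oplus_prime (j q : nat) : Prop :=
  match j with
  | 1 => prime q
  | 2 => exp_prime q
  | _ => False
  end.

(* The expression with data (b_1, q_1), ..., (b_m, q_m) is encoded by the
   sequence s of these pairs, the outermost (rightmost) operand coming first.
   The empty expression is the left identity 1 of (+)_(i-1), so that the
   innermost operand stands alone (expr_value1). *)
Definition expr_value (i : nat) (s : seq (nat * nat)) : nat :=
  foldr (fun p acc => oplus i.-1 acc (oplus_left i p.1 p.2)) 1 s.

Lemma expr_value1 i b q : i = 2 \/ i = 3 ->
  expr_value i [:: (b, q)] = oplus_left i b q.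
Proof. by case=> ->; rewrite /= ?mul1n ?expn1. Qed.

(* At the innermost pair the non-divisibility condition reads ~~ (q %| 1),
   which is automatic unless q = 1. *)
Definition admissible (i : nat) (s : seq (nat * nat)) : Prop :=
  forall k, k < size s ->
    let: (b, q) := nth (0, 0) s k in
    [/\ 0 < b, oplus_prime i.-1 q & ~~ (q %| expr_value i (drop k.+1 s))].

(* Main.v *)
(** For [i = 2] the data of an admissible expression are the pairs
    [(logn p n, p)] for the primes [p] dividing [n], in any order.  For [i = 3],
    peeling off the outermost pair [(b, q)] writes [n] as
    [q ^ (q ^ b.-1 * m)] with [m] the value of the rest: [q] is the unique
    exponential prime of which [n > 1] is a power (compare prime valuations),
    and [b], [m] are forced because [q] does not divide [m]. *)
Require Import Defs.
From mathcomp Require Import all_boot.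

(** The root is built by dividing every exponent of the prime factorization of [q] by [f]. *)
Lemma root_of_dvdn_logn f q :
  0 < q -> (forall p, f %| logn p q) -> exists c, q = c ^ f.
Proof.
move=> q_gt0 f_dvd; exists (\prod_(p <- primes q) p ^ (logn p q %/ f)).
rewrite {1}[q]prod_prime_decomp // prime_decompE big_map /=.
rewrite (big_morph (fun x => x ^ f) (fun x y => expnMn x y f) (exp1n f)).
by apply: eq_bigr => p _; rewrite -expnM divnK.
Qed.

(** At each prime the valuations satisfy [e * logn p q = f * logn p r], and Gauss's lemma removes
    the coprime factor [e]. *)
Lemma root_of_coprime_expn q r e f :
  0 < q -> coprime f e -> q ^ e = r ^ f -> exists c, q = c ^ f.
Proof.
move=> q_gt0 cop_fe eq_qr; apply: root_of_dvdn_logn => // p.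
by rewrite -(Gauss_dvdr _ cop_fe) -lognX eq_qr lognX dvdn_mulr.
Qed.

Lemma exp_prime_exponent q c f : 1 < q -> exp_prime q -> q = c ^ f -> f = 1.
Proof.
move=> q_gt1 [_ q_prime] def_q; case: f def_q => [|[|f]] // def_q.
  by rewrite def_q in q_gt1.
case: q_prime; exists c, f.+2; split=> //; rewrite ltnNge.
by apply/negP; case: c def_q => [|[|]] // def_q; rewrite def_q ?exp0n ?exp1n in q_gt1.
Qed.

(** Dividing both exponents by their gcd makes them coprime; then [q] is a power with the reduced
    [f] as exponent and [r] one with the reduced [e]. Exponential primality forces both reduced
    exponents to be 1. *)
Lemma exp_prime_expn_inj q r e f :
    exp_prime q -> exp_prime r -> 1 < q -> 1 < r -> 0 < e ->
  q ^ e = r ^ f -> q = r /\ e = f.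
Proof.
move=> q_prime r_prime q_gt1 r_gt1 e_gt0 eq_qr.
have g_gt0 : 0 < gcdn e f by rewrite gcdn_gt0 e_gt0.
have cop : coprime (e %/ gcdn e f) (f %/ gcdn e f).
  rewrite /coprime -(eqn_pmul2r g_gt0) muln_gcdl !divnK ?mul1n //.
    exact: dvdn_gcdr.
  exact: dvdn_gcdl.
have eq_root : q ^ (e %/ gcdn e f) = r ^ (f %/ gcdn e f).
  apply/eqP; rewrite -(eqn_exp2r _ _ g_gt0) -!expnM !divnK ?dvdn_gcdl ?dvdn_gcdr //.
  exact/eqP.
have [c def_q] : exists c, q = c ^ (f %/ gcdn e f).
  by apply: root_of_coprime_expn eq_root; rewrite ?(ltnW q_gt1) // coprime_sym.
have [d def_r] : exists d, r = d ^ (e %/ gcdn e f).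
  by apply: root_of_coprime_expn (esym eq_root); rewrite ?(ltnW r_gt1).
have f1 := exp_prime_exponent _ _ _ q_gt1 q_prime def_q.
have e1 := exp_prime_exponent _ _ _ r_gt1 r_prime def_r.
move: eq_root; rewrite e1 f1 !expn1; split=> //.
(* Both [e] and [f] equal their gcd. *)
by rewrite -(divnK (dvdn_gcdl e f)) e1 -{2}(divnK (dvdn_gcdr e f)) f1.
Qed.

(** Take the least base [q] of which [n] is a power: if [q] were [u ^ v] with [u, v > 1], then [u]
    would be a smaller such base. *)
Lemma exp_prime_root n :
  1 < n -> exists q e, [/\ exp_prime q, 1 < q, 0 < e & n = q ^ e].
Proof.
move=> n_gt1.
(* Bounding the exponent by [n] makes the property boolean, as a minimum search requires. *)
have exq : exists q, [exists e : 'I_n.+1, n == q ^ e].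
  have lt_1n : 1 < n.+1 by exact: ltnW.
  by exists n; apply/existsP; exists (Ordinal lt_1n); rewrite /= expn1.
case: (ex_minnP exq) => q /existsP[e /eqP def_n] q_min.
have e_gt0 : 0 < e.
  by rewrite lt0n; apply: contraL n_gt1 => /eqP e0; rewrite def_n e0.
have q_gt1 : 1 < q.
  by case: q def_n {q_min} => [|[|q]] // def_n; rewrite def_n ?exp0n ?exp1n in n_gt1.
exists q, e; split=> //; split=> [|[u [v [u_gt1 v_gt1 def_q]]]]; first exact: ltnW.
have /q_min : [exists e : 'I_n.+1, n == u ^ e].
  have def_n' : n = u ^ (v * e) by rewrite expnM -def_q.
  (* The new exponent respects the bound because [u > 1] gives [v * e < u ^ (v * e) = n]. *)
  have lt_ve : v * e < n.+1 by rewrite ltnS {2}def_n' ltnW // ltn_expl.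
  by apply/existsP; exists (Ordinal lt_ve); rewrite -def_n'.
by rewrite def_q leqNgt -{1}(expn1 u) ltn_exp2l ?v_gt1.
Qed.

Lemma admissible_nil i : admissible i [::].
Proof. by move=> k; rewrite ltn0. Qed.

Lemma admissible_cons i b q s :
  admissible i ((b, q) :: s) <->
  [/\ 0 < b, oplus_prime i.-1 q & ~~ (q %| expr_value i s)] /\ admissible i s.
Proof.
split=> [adm | [adm_bq adm_s] [|k] lt_k].
- by split=> [|k lt_k]; [have := adm 0 isT; rewrite /= drop0 | apply: (adm k.+1)].
- by rewrite /= drop0.
- exact: adm_s.
Qed.

Lemma expr_value2_cons b q s :
  expr_value 2 ((b, q) :: s) = q ^ b * expr_value 2 s.
Proof. by rewrite /= oplus_left2E mulnC. Qed.

Lemma expr_value3_cons b q s : 0 < b ->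
  expr_value 3 ((b, q) :: s) = q ^ (q ^ b.-1 * expr_value 3 s).
Proof. by move=> b_gt0; rewrite [LHS]/= oplus_left3E // -expnM. Qed.

Lemma expr_value2_gt0 s : admissible 2 s -> 0 < expr_value 2 s.
Proof.
elim: s => [|[b q] s IHs] // /admissible_cons[[_ q_prime _] /IHs s_gt0].
by rewrite expr_value2_cons muln_gt0 expn_gt0 prime_gt0.
Qed.

(** Excludes the exponential prime 1, which divides everything. *)
Lemma ndvdn_gt1 q m : 0 < q -> ~~ (q %| m) -> 1 < q.
Proof. by case: q => [|[|q]] //; rewrite dvd1n. Qed.

Lemma expr_value3_gt0 s : admissible 3 s -> 0 < expr_value 3 s.
Proof.
case: s => [|[b q] s] // /admissible_cons[[b_gt0 [q_gt0 _] _] _].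
by rewrite expr_value3_cons // expn_gt0 q_gt0.
Qed.

(** Separates nonempty expressions from the empty one, whose value is 1. *)
Lemma expr_value3_cons_gt1 p s :
  admissible 3 (p :: s) -> 1 < expr_value 3 (p :: s).
Proof.
case: p => b q /admissible_cons[[b_gt0 [q_gt0 _] qNs] adm_s].
have q_gt1 := ndvdn_gt1 _ _ q_gt0 qNs.
rewrite expr_value3_cons //; apply: leq_ltn_trans (ltn_expl _ q_gt1).
by rewrite muln_gt0 expn_gt0 q_gt0 expr_value3_gt0.
Qed.

(** Here [q] may be composite, so [q] itself is divided out repeatedly instead of using a prime
    valuation. *)
Lemma dvdn_power_split q e :
  1 < q -> 0 < e -> exists k m, ~~ (q %| m) /\ e = q ^ k * m.
Proof.
move=> q_gt1; elim/ltn_ind: e => e IHe e_gt0.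
have [/dvdnP[d def_e] | qNe] := boolP (q %| e); last by exists 0, e; rewrite mul1n.
have d_gt0 : 0 < d by case: d def_e e_gt0 => // ->.
have [|k [m [qNm def_d]]] := IHe d _ d_gt0; first by rewrite def_e ltn_Pmulr.
by exists k.+1, m; rewrite def_e def_d expnSr mulnAC.
Qed.

(** Cancel common factors [q]; one left over on a single side would divide [m] or [m']. *)
Lemma dvdn_power_split_inj q k l m m' :
    0 < q -> ~~ (q %| m) -> ~~ (q %| m') -> q ^ k * m = q ^ l * m' ->
  k = l /\ m = m'.
Proof.
move=> q_gt0 qNm qNm'; elim: k l => [|k IHk] [|l].
- by rewrite !mul1n.
- by rewrite mul1n expnS -mulnA => def_m; rewrite def_m dvdn_mulr in qNm.
- by rewrite mul1n expnS -mulnA => def_m'; rewrite -def_m' dvdn_mulr in qNm'.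
rewrite !expnS -!mulnA => /eqP; rewrite eqn_pmul2l // => /eqP /IHk[-> ->].
by [].
Qed.

Lemma admissible2_exists n :
  0 < n -> exists s, admissible 2 s /\ expr_value 2 s = n.
Proof.
elim/ltn_ind: n => n IHn n_gt0.
have [n_le1 | n_gt1] := leqP n 1.
  exists [::]; split; first exact: admissible_nil.
  by apply/eqP; rewrite eqn_leq n_le1 n_gt0.
(* Strip the full power of the least prime divisor, leaving a smaller coprime cofactor. *)
have p_prime := pdiv_prime n_gt1.
have [m cop_pm def_n] := pfactor_coprime p_prime n_gt0.
have b_gt0 : 0 < logn (pdiv n) n by rewrite logn_gt0 mem_primes p_prime n_gt0 pdiv_dvd.
have m_gt0 : 0 < m by case: m def_n {cop_pm} n_gt0 => // ->.
have lt_mn : m < n.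
  rewrite [ltnRHS]def_n ltn_Pmulr //.
  exact: leq_ltn_trans b_gt0 (ltn_expl _ (prime_gt1 p_prime)).
have [s [adm_s val_s]] := IHn m lt_mn m_gt0.
exists ((logn (pdiv n) n, pdiv n) :: s); split; last first.
  by rewrite expr_value2_cons val_s mulnC -def_n.
by apply/admissible_cons; rewrite val_s -prime_coprime.
Qed.

Lemma admissible3_exists n :
  0 < n -> exists s, admissible 3 s /\ expr_value 3 s = n.
Proof.
elim/ltn_ind: n => n IHn n_gt0.
have [n_le1 | n_gt1] := leqP n 1.
  exists [::]; split; first exact: admissible_nil.
  by apply/eqP; rewrite eqn_leq n_le1 n_gt0.
have [q [e [q_prime q_gt1 e_gt0 def_n]]] := exp_prime_root n n_gt1.
have [k [m [qNm def_e]]] := dvdn_power_split q e q_gt1 e_gt0.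
have m_gt0 : 0 < m by case: m def_e {qNm} e_gt0 => // ->; rewrite muln0.
have lt_mn : m < n.
  apply: leq_ltn_trans (_ : e < n); last by rewrite def_n ltn_expl.
  by rewrite def_e leq_pmull // expn_gt0 ltnW.
have [s [adm_s val_s]] := IHn m lt_mn m_gt0.
(* A pair [(b, q)] contributes [q ^ b.-1] to the exponent, hence [b = k.+1]. *)
exists ((k.+1, q) :: s); split; last by rewrite expr_value3_cons // val_s -def_e.
by apply/admissible_cons; rewrite val_s.
Qed.

(** Prepending [(b, q)] adds one new prime [q] of valuation [b] and leaves the other valuations
    unchanged. *)
Lemma admissible2_perm s : admissible 2 s ->
  perm_eq s [seq (logn p (expr_value 2 s), p) | p <- primes (expr_value 2 s)].
Proof.
elim: s => [|[b q] s IHs] // /admissible_cons[[b_gt0 q_prime qNs] adm_s].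
have s_gt0 := expr_value2_gt0 s adm_s.
have qb_gt0 : 0 < q ^ b by rewrite expn_gt0 prime_gt0.
rewrite expr_value2_cons; set m := expr_value 2 s in IHs qNs s_gt0 *.
have primes_eq : perm_eq (primes (q ^ b * m)) (q :: primes m).
  apply: uniq_perm => [||p]; first exact: primes_uniq.
    by rewrite /= primes_uniq mem_primes q_prime s_gt0 (negbTE qNs).
  by rewrite primesM // primesX // primes_prime // !inE.
rewrite perm_sym (perm_trans (perm_map _ primes_eq)) //= perm_sym.
rewrite lognM // pfactorK // (logn_coprime (m := m)) ?prime_coprime // addn0.
rewrite perm_cons.
suff -> : [seq (logn p (q ^ b * m), p) | p <- primes m]
  = [seq (logn p m, p) | p <- primes m] by exact: IHs.
apply/eq_in_map => p; rewrite mem_primes => /and3P[p_prime _ p_dvd].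
have neq_pq : p != q by apply: contraNneq qNs => <-.
by rewrite lognM // lognX logn_prime // (negbTE neq_pq) muln0.
Qed.

Lemma admissible3_inj s t :
  admissible 3 s -> admissible 3 t -> expr_value 3 t = expr_value 3 s -> t = s.
Proof.
elim: s t => [|[b q] s IHs] [|[c r] t] // adm_s adm_t.
- by move=> val_t; have := expr_value3_cons_gt1 _ _ adm_t; rewrite val_t.
- by move=> val_s; have := expr_value3_cons_gt1 _ _ adm_s; rewrite -val_s.
move/admissible_cons: adm_s => [[b_gt0 q_prime qNs] adm_s].
move/admissible_cons: adm_t => [[c_gt0 r_prime rNt] adm_t].
have q_gt1 : 1 < q by apply: ndvdn_gt1 qNs; case: q_prime.
have r_gt1 : 1 < r by apply: ndvdn_gt1 rNt; case: r_prime.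
rewrite !expr_value3_cons // => /exp_prime_expn_inj[] //.
  by rewrite muln_gt0 expn_gt0 ltnW // expr_value3_gt0.
move=> eq_rq; rewrite eq_rq in rNt *.
(* With equal bases, the exponents are two splittings of one number into a power of [q] and a factor
   that [q] does not divide. *)
case/dvdn_power_split_inj=> // [|eq_cb /IHs ->] //; first exact: ltnW.
by rewrite -(prednK b_gt0) -(prednK c_gt0) eq_cb.
Qed.

Theorem theorem9 (i n : nat) (hi : i = 2 \/ i = 3) (hn : 0 < n) :
  exists s : seq (nat * nat),
    [/\ admissible i s, expr_value i s = n
      & forall t : seq (nat * nat), admissible i t -> expr_value i t = n ->
          if i == 2 then perm_eq t s else t == s].
Proof.
case: hi => -> /=.
  have [s [adm_s val_s]] := admissible2_exists n hn.
  (* Both sequences are permutations of the list of pairs read off from [n]. *)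
  exists s; split=> // t /admissible2_perm perm_t val_t.
  have perm_s := admissible2_perm s adm_s.
  by rewrite (perm_trans perm_t) // perm_sym val_t -val_s.
have [s [adm_s val_s]] := admissible3_exists n hn.
exists s; split=> // t adm_t val_t.
by apply/eqP/admissible3_inj; rewrite // val_t.
Qed.
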